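(* Let $K\subseteq\mathbb{R}^d$ be any compact set. Then the set $\{(\varphi|_K,d\varphi|_K):\varphi\in C_c^\infty(\mathbb{R}^d)\}$ is dense in $(\mathcal{J}^1(K),\|\cdot\|_{\mathcal{J}^1(K)})$. Consequently, $C^1(\mathbb{R}^d|K)=\{f|_K: f\in C^1(\mathbb{R}^d)\}$ is dense in $(C^1(K),\|\cdot\|_{C^1(K)})$.
   Context: A continuous $df:K\to\mathbb{R}^d$ is a continuous derivative of $f:K\to\mathbb{R}$ on $K$ if $\lim_{y\to x,\,y\in K\setminus\{x\}}\frac{f(y)-f(x)-\langle df(x),y-x\rangle}{|y-x|}=0$ for all $x\in K$. $\mathcal{J}^1(K)=\{(f,df): df \text{ is a continuous derivative of } f \text{ on } K\}$ with norm $\|f\|_K+\|df\|_K$ ($\|\cdot\|_K$ the sup norm). $C^1(K)$ is its projection onto the first coordinate with quotient norm $\|f\|_{C^1(K)}=\|f\|_K+\inf\{\|df\|_K: df \text{ a continuous derivative of } f\}$. *)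

(* Defs.v *)
From Stdlib Require Import Reals List.
Open Scope R_scope.

(* Points of R^d are encoded as sequences nat -> R vanishing from index d on. *)
Definition pt := nat -> R.
Definition inRd (d : nat) (x : pt) : Prop := forall i, (d <= i)%nat -> x i = 0.

Fixpoint sumd (d : nat) (f : nat -> R) : R :=
  match d with O => 0 | S n => sumd n f + f n end.

Definition vnorm (d : nat) (x : pt) : R := sqrt (sumd d (fun i => x i ^ 2)).
Definition vsub (x y : pt) : pt := fun i => x i - y i.
Definition dotd (d : nat) (x y : pt) : R := sumd d (fun i => x i * y i).

Definition openRd (d : nat) (U : pt -> Prop) : Prop :=
  forall x, inRd d x -> U x ->
    exists r, 0 < r /\ forall y, inRd d y -> vnorm d (vsub y x) < r -> U y.

Definition compactRd (d : nat) (K : pt -> Prop) : Prop :=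
  (forall x, K x -> inRd d x) /\
  forall (I : Type) (U : I -> pt -> Prop),
    (forall i, openRd d (U i)) ->
    (forall x, K x -> exists i, U i x) ->
    exists l : list I, forall x, K x -> exists i, In i l /\ U i x.

Definition contR_on (d : nat) (S : pt -> Prop) (g : pt -> R) : Prop :=
  forall x, S x -> forall eps, 0 < eps -> exists delta, 0 < delta /\
    forall y, S y -> vnorm d (vsub y x) < delta -> Rabs (g y - g x) < eps.

Definition contV_on (d : nat) (S : pt -> Prop) (v : pt -> pt) : Prop :=
  forall x, S x -> forall eps, 0 < eps -> exists delta, 0 < delta /\
    forall y, S y -> vnorm d (vsub y x) < delta -> vnorm d (vsub (v y) (v x)) < eps.

Definition is_cont_deriv (d : nat) (K : pt -> Prop) (f : pt -> R) (df : pt -> pt) : Prop :=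
  contV_on d K df /\
  forall x, K x -> forall eps, 0 < eps -> exists delta, 0 < delta /\
    forall y, K y -> 0 < vnorm d (vsub y x) < delta ->
      Rabs (f y - f x - dotd d (df x) (vsub y x)) <= eps * vnorm d (vsub y x).

(* smoothness on R^d: D a is the iterated partial derivative d_{a_1} ... d_{a_k} phi;
   all exist and are continuous *)
Definition upd (x : pt) (i : nat) (t : R) : pt :=
  fun j => if Nat.eqb j i then t else x j.

Definition smooth_family (d : nat) (phi : pt -> R) (D : list nat -> pt -> R) : Prop :=
  (forall x, inRd d x -> D nil x = phi x) /\
  forall a : list nat, (forall j, In j a -> (j < d)%nat) ->
    contR_on d (inRd d) (D a) /\
    forall i, (i < d)%nat -> forall x, inRd d x ->
      derivable_pt_lim (fun t => D a (upd x i t)) (x i) (D (i :: a) x).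

Definition compact_support (d : nat) (phi : pt -> R) : Prop :=
  exists M, forall x, inRd d x -> M < vnorm d x -> phi x = 0.

Definition gradD (D : list nat -> pt -> R) (x : pt) : pt := fun i => D (i :: nil) x.

(* Main.v *)
(** A function with a continuous derivative [F] on a compact set need not satisfy Whitney's
    uniform condition, but it is close to functions satisfying it up to [eps] at some
    scale [r]: let [u x] be the infimum of
    [f x_0 + sum_i (<F x_i, x_{i+1} - x_i> + eps |x_{i+1} - x_i|)] over the chains in [K]
    from any [x_0] to [x] with steps of length at most [r].  Concatenation with one more
    step gives [|u y - u x - <F x, y - x>| <= 2 eps |y - x|] for [|y - x| <= r].
    Trivially [u <= f], and compactness shows that chains cannot gain more than [eps] when
    [r] is small.  Blending the first-order expansions of [u] with a smooth partition of
    unity on a grid of mesh much smaller than [r] gives a smooth function whose gradient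
    differs from [F] by a multiple of [eps] depending only on [d]. *)

Require Import Defs.
From Stdlib Require Import Reals List Lra Lia ZArith ClassicalEpsilon FunctionalExtensionality.
Open Scope R_scope.

(** * Euclidean norm and compactness *)

Lemma sumd_ext (d : nat) (f g : nat -> R) :
  (forall i, (i < d)%nat -> f i = g i) -> sumd d f = sumd d g.
Proof.
  induction d as [|d IH]; intros H; simpl; [reflexivity|].
  rewrite IH, H; auto.
Qed.

Lemma sumd_plus (d : nat) (f g : nat -> R) :
  sumd d (fun i => f i + g i) = sumd d f + sumd d g.
Proof. induction d; simpl; lra. Qed.

Lemma sumd_scal (d : nat) (c : R) (f : nat -> R) :
  sumd d (fun i => c * f i) = c * sumd d f.
Proof. induction d as [|d IH]; simpl; [lra|rewrite IH; lra]. Qed.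

Lemma sumd_le (d : nat) (f g : nat -> R) :
  (forall i, (i < d)%nat -> f i <= g i) -> sumd d f <= sumd d g.
Proof.
  induction d as [|d IH]; intros H; simpl; [lra|].
  apply Rplus_le_compat; auto.
Qed.

Lemma sumd_const (d : nat) (c : R) : sumd d (fun _ => c) = INR d * c.
Proof. induction d as [|d IH]; [simpl; lra|rewrite S_INR; simpl sumd; lra]. Qed.

Lemma sumd_eq0 (d : nat) (f : nat -> R) :
  (forall i, (i < d)%nat -> f i = 0) -> sumd d f = 0.
Proof.
  intros H. rewrite (sumd_ext d f (fun _ => 0) H), sumd_const; lra.
Qed.

Lemma sumd_nonneg (d : nat) (f : nat -> R) :
  (forall i, (i < d)%nat -> 0 <= f i) -> 0 <= sumd d f.
Proof.
  intros H. rewrite <- (sumd_eq0 d (fun _ => 0)) by auto. now apply sumd_le.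
Qed.

Lemma sumd_single (d : nat) (f : nat -> R) (j : nat) :
  (j < d)%nat -> (forall i, i <> j -> f i = 0) -> sumd d f = f j.
Proof.
  induction d as [|d IH]; intros Hj H; [lia|]; simpl.
  destruct (Nat.eq_dec j d) as [->|n].
  - rewrite sumd_eq0; [lra|]. intros i Hi; apply H; lia.
  - rewrite IH, (H d); [lra|lia|lia|auto].
Qed.

(** Needed on the grid, where at most two consecutive bumps survive at a given point. *)
Lemma sumd_two (d : nat) (f : nat -> R) (j : nat) :
  (S j < d)%nat -> (forall i, i <> j -> i <> S j -> f i = 0) ->
  sumd d f = f j + f (S j).
Proof.
  intros Hj H.
  rewrite (sumd_ext d f (fun i => (if Nat.eqb i j then f i else 0)
                            + (if Nat.eqb i (S j) then f i else 0))).
  - rewrite sumd_plus, (sumd_single _ _ j), (sumd_single _ _ (S j)); try lia.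
    + now rewrite !Nat.eqb_refl.
    + intros i Hi. apply Nat.eqb_neq in Hi. now rewrite Hi.
    + intros i Hi. apply Nat.eqb_neq in Hi. now rewrite Hi.
  - intros i _.
    destruct (Nat.eqb_spec i j); destruct (Nat.eqb_spec i (S j)); try lia; try lra.
    rewrite H; auto; lra.
Qed.

Lemma sumd_term_le (d : nat) (f : nat -> R) (j : nat) :
  (forall i, 0 <= f i) -> (j < d)%nat -> f j <= sumd d f.
Proof.
  induction d as [|d IH]; intros H Hj; [lia|]; simpl.
  destruct (Nat.eq_dec j d) as [->|n].
  - assert (0 <= sumd d f) by (apply sumd_nonneg; auto). lra.
  - assert (f j <= sumd d f) by (apply IH; auto; lia). specialize (H d); lra.
Qed.

Lemma vnorm_nonneg (d : nat) (x : pt) : 0 <= vnorm d x.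
Proof. apply sqrt_pos. Qed.

Lemma vnorm_sqr (d : nat) (x : pt) : vnorm d x ^ 2 = sumd d (fun i => x i ^ 2).
Proof.
  unfold vnorm. rewrite pow2_sqrt; [reflexivity|].
  apply sumd_nonneg; intros; apply pow2_ge_0.
Qed.

Lemma vnorm_ext (d : nat) (x y : pt) :
  (forall i, (i < d)%nat -> x i = y i) -> vnorm d x = vnorm d y.
Proof.
  intros H. unfold vnorm. f_equal. apply sumd_ext. intros i Hi. now rewrite H.
Qed.

Lemma vnorm_le_sqr (d : nat) (x : pt) (c : R) :
  0 <= c -> sumd d (fun i => x i ^ 2) <= c ^ 2 -> vnorm d x <= c.
Proof.
  intros Hc H. unfold vnorm. rewrite <- (sqrt_pow2 c Hc). now apply sqrt_le_1_alt.
Qed.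

Lemma coord_le_vnorm (d : nat) (x : pt) (i : nat) :
  (i < d)%nat -> Rabs (x i) <= vnorm d x.
Proof.
  intros Hi.
  rewrite <- (sqrt_pow2 (Rabs (x i))) by apply Rabs_pos.
  apply sqrt_le_1_alt. rewrite pow2_abs.
  apply (sumd_term_le d (fun i => x i ^ 2)); auto. intros; apply pow2_ge_0.
Qed.

(** The sharp factor is [sqrt (INR d)]; the cruder [INR d] follows from [d c^2 <= (d c)^2] and only
    affects constants depending on the dimension. *)
Lemma vnorm_le_coord (d : nat) (x : pt) (c : R) :
  0 <= c -> (forall i, (i < d)%nat -> Rabs (x i) <= c) -> vnorm d x <= INR d * c.
Proof.
  intros Hc H.
  assert (Hd := pos_INR d).
  apply vnorm_le_sqr; [now apply Rmult_le_pos|].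
  apply Rle_trans with (sumd d (fun _ => c ^ 2)).
  - apply sumd_le; intros i Hi. rewrite <- pow2_abs. apply pow_incr; split; auto using Rabs_pos.
  - rewrite sumd_const. destruct d as [|d]; [simpl; lra|].
    assert (1 <= INR (S d)) by (rewrite S_INR; assert (H0 := pos_INR d); lra).
    assert (0 <= c ^ 2) by apply pow2_ge_0. nra.
Qed.

Lemma cauchy_schwarz_sqr (d : nat) (x y : pt) :
  dotd d x y ^ 2 <= sumd d (fun i => x i ^ 2) * sumd d (fun i => y i ^ 2).
Proof.
  unfold dotd. induction d as [|d IH]; cbn [sumd]; [lra|].
  set (X := sumd d (fun i => x i * y i)) in *.
  set (A := sumd d (fun i => x i ^ 2)) in *. set (B := sumd d (fun i => y i ^ 2)) in *.
  assert (HA : 0 <= A) by (apply sumd_nonneg; intros; apply pow2_ge_0).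
  assert (HB : 0 <= B) by (apply sumd_nonneg; intros; apply pow2_ge_0).
  set (a := x d). set (b := y d).
  (* This cross-term bound is proved by squaring: [X^2 <= A B] by induction, and
     [4 A B a^2 b^2 <= (A b^2 + B a^2)^2] since the difference is a square. *)
  enough (2 * X * (a * b) <= A * b ^ 2 + B * a ^ 2) by nra.
  apply Rsqr_incr_0_var.
  - unfold Rsqr.
    assert (0 <= (A * b ^ 2 - B * a ^ 2) ^ 2) by apply pow2_ge_0.
    assert (0 <= (a * b) ^ 2) by apply pow2_ge_0.
    assert (X ^ 2 * (a * b) ^ 2 <= A * B * (a * b) ^ 2) by (apply Rmult_le_compat_r; auto).
    nra.
  - assert (0 <= a ^ 2) by apply pow2_ge_0. assert (0 <= b ^ 2) by apply pow2_ge_0. nra.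
Qed.

Lemma cauchy_schwarz (d : nat) (x y : pt) :
  Rabs (dotd d x y) <= vnorm d x * vnorm d y.
Proof.
  assert (Hx := vnorm_nonneg d x). assert (Hy := vnorm_nonneg d y).
  assert (Hm : 0 <= vnorm d x * vnorm d y) by now apply Rmult_le_pos.
  apply Rsqr_incr_0_var; auto.
  rewrite <- Rsqr_abs. unfold Rsqr.
  assert (H := cauchy_schwarz_sqr d x y). rewrite <- !vnorm_sqr in H. nra.
Qed.

Lemma vnorm_vsub_sym (d : nat) (x y : pt) : vnorm d (vsub x y) = vnorm d (vsub y x).
Proof.
  unfold vnorm. f_equal. apply sumd_ext; intros; unfold vsub; ring.
Qed.

Lemma vnorm_vsub_diag (d : nat) (x : pt) : vnorm d (vsub x x) = 0.
Proof.
  unfold vnorm. rewrite sumd_eq0; [apply sqrt_0|]. intros; unfold vsub; ring.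
Qed.

Lemma vnorm_triangle (d : nat) (x y z : pt) :
  vnorm d (vsub x z) <= vnorm d (vsub x y) + vnorm d (vsub y z).
Proof.
  assert (H1 := vnorm_nonneg d (vsub x y)). assert (H2 := vnorm_nonneg d (vsub y z)).
  apply vnorm_le_sqr; [lra|].
  replace (sumd d (fun i => vsub x z i ^ 2))
    with (vnorm d (vsub x y) ^ 2 + 2 * dotd d (vsub x y) (vsub y z) + vnorm d (vsub y z) ^ 2).
  - assert (H := cauchy_schwarz d (vsub x y) (vsub y z)).
    assert (H' := Rle_abs (dotd d (vsub x y) (vsub y z))). nra.
  - rewrite !vnorm_sqr. unfold dotd. rewrite <- sumd_scal, <- !sumd_plus.
    apply sumd_ext; intros; unfold vsub; ring.
Qed.

Lemma dotd_vsub_r (d : nat) (v x y z : pt) :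
  dotd d v (vsub x z) = dotd d v (vsub x y) + dotd d v (vsub y z).
Proof.
  unfold dotd. rewrite <- sumd_plus. apply sumd_ext; intros; unfold vsub; ring.
Qed.

Lemma dotd_vsub_l (d : nat) (v w x : pt) :
  dotd d (vsub v w) x = dotd d v x - dotd d w x.
Proof.
  unfold Rminus. rewrite <- (Rmult_1_l (dotd d w x)), Ropp_mult_distr_l.
  unfold dotd. rewrite <- sumd_scal, <- sumd_plus.
  apply sumd_ext; intros; unfold vsub; ring.
Qed.

Lemma dotd_vsub_opp (d : nat) (v x y : pt) :
  dotd d v (vsub x y) = - dotd d v (vsub y x).
Proof.
  rewrite <- (Rmult_1_l (dotd d v (vsub y x))), Ropp_mult_distr_l.
  unfold dotd. rewrite <- sumd_scal. apply sumd_ext; intros; unfold vsub; ring.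
Qed.

(** A Lebesgue-number argument: the cover is indexed by pairs of a centre and a radius, and [r] is a
    lower bound for the positive radii in a finite subcover. Local data at the centres thus become
    available at a common scale. *)
Lemma compact_cover (d : nat) (K : pt -> Prop) (P : pt -> R -> Prop) :
  compactRd d K ->
  (forall z, K z -> exists rho, 0 < rho /\ P z rho) ->
  exists r, 0 < r /\ forall x, K x ->
    exists z rho, K z /\ P z rho /\ r <= rho /\ vnorm d (vsub x z) < rho.
Proof.
  intros [_ HK] H.
  destruct (HK (pt * R)%type
              (fun zr x => K (fst zr) /\ P (fst zr) (snd zr) /\ vnorm d (vsub x (fst zr)) < snd zr))
    as [l Hl].
  - intros [z rho] x _ (Kz & Pz & Hx); simpl in *.
    exists (rho - vnorm d (vsub x z)); split; [lra|].
    intros y _ Hy; repeat split; auto.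
    assert (T := vnorm_triangle d y x z). lra.
  - intros x Kx. destruct (H x Kx) as (rho & Hr & Px).
    exists (x, rho); simpl. rewrite vnorm_vsub_diag. auto.
  - assert (exists r, 0 < r /\ forall zr, In zr l -> 0 < snd zr -> r <= snd zr) as (r & Hr & Hmin).
    { clear. induction l as [|[z rho] l (r & Hr & IH)].
      - exists 1; split; [lra|]. intros _ [].
      - destruct (Rlt_dec 0 rho).
        + exists (Rmin rho r); split; [now apply Rmin_pos|].
          intros zr [<-|Hin] Hp; [apply Rmin_l|].
          apply Rle_trans with r; [apply Rmin_r|auto].
        + exists r; split; auto. intros zr [<-|Hin] Hp; [simpl in Hp; lra|auto]. }
    exists r; split; auto. intros x Kx.
    destruct (Hl x Kx) as ([z rho] & Hin & Kz & Pz & Hx); simpl in *.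
    exists z, rho; repeat split; auto. apply (Hmin _ Hin); simpl.
    assert (N := vnorm_nonneg d (vsub x z)); lra.
Qed.

Lemma compact_coord_bounded (d : nat) (K : pt -> Prop) :
  compactRd d K -> exists M, 0 < M /\ forall x i, K x -> (i < d)%nat -> Rabs (x i) <= M.
Proof.
  intros [_ HK].
  destruct (HK nat (fun n x => vnorm d (vsub x (fun _ => 0)) < INR n)) as [l Hl].
  - intros n x _ Hx. exists (INR n - vnorm d (vsub x (fun _ => 0))); split; [lra|].
    intros y _ Hy. assert (T := vnorm_triangle d y x (fun _ => 0)); lra.
  - intros x _. apply INR_unbounded.
  - exists (INR (S (list_max l))); split; [apply lt_0_INR; lia|].
    intros x i Kx Hi. destruct (Hl x Kx) as (n & Hin & Hn).
    assert (Hle : (n <= list_max l)%nat).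
    { assert (F := proj1 (list_max_le l (list_max l)) (le_n _)).
      rewrite Forall_forall in F. auto. }
    apply le_INR in Hle. rewrite S_INR.
    assert (C := coord_le_vnorm d (vsub x (fun _ => 0)) i Hi).
    unfold vsub at 1 in C. rewrite Rminus_0_r in C. lra.
Qed.

Lemma compact_contV_uniform (d : nat) (K : pt -> Prop) (F : pt -> pt) (eps : R) :
  compactRd d K -> contV_on d K F -> 0 < eps ->
  exists r, 0 < r /\ forall x y, K x -> K y -> vnorm d (vsub y x) < r ->
    vnorm d (vsub (F y) (F x)) <= eps.
Proof.
  intros HK HF He.
  (* The doubled radius keeps every [y] within [r <= rho] of [x] inside the ball where [F] is
     compared with [F z]. *)
  destruct (compact_cover d K (fun z rho => forall y, K y -> vnorm d (vsub y z) < 2 * rho ->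
     vnorm d (vsub (F y) (F z)) < eps / 2) HK) as (r & Hr & H).
  - intros z Kz. destruct (HF z Kz (eps / 2)) as (del & Hdel & H); [lra|].
    exists (del / 2); split; [lra|]. intros y Ky Hy; apply H; auto; lra.
  - exists r; split; auto. intros x y Kx Ky Hxy.
    destruct (H x Kx) as (z & rho & Kz & Hz & Hle & Hxz).
    assert (T := vnorm_triangle d y x z).
    assert (T' := vnorm_triangle d (F y) (F z) (F x)).
    rewrite (vnorm_vsub_sym d (F z) (F x)) in T'.
    assert (A1 := Hz x Kx ltac:(lra)). assert (A2 := Hz y Ky ltac:(lra)). lra.
Qed.

(** * Chains *)

Lemma vnorm_vsub_eq0 (d : nat) (x y : pt) :
  inRd d x -> inRd d y -> vnorm d (vsub x y) = 0 -> x = y.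
Proof.
  intros Hx Hy H. apply functional_extensionality; intros i.
  destruct (Nat.lt_ge_cases i d) as [Hi|Hi].
  - assert (C := coord_le_vnorm d (vsub x y) i Hi). rewrite H in C.
    assert (P := Rabs_pos (vsub x y i)).
    apply Rminus_diag_uniq. change (vsub x y i = 0).
    destruct (Req_dec (vsub x y i) 0) as [|N]; auto.
    apply Rabs_pos_lt in N. lra.
  - now rewrite Hx, Hy.
Qed.

(** Only the endpoint and the cost of a chain matter later, so chains are encoded as a relation
    between the two; induction peels off the last step. *)
Inductive chain_cost (d : nat) (K : pt -> Prop) (f : pt -> R) (F : pt -> pt) (eps r : R) :
  pt -> R -> Prop :=
| chain_start x : K x -> chain_cost d K f F eps r x (f x)
| chain_step x y c :
    chain_cost d K f F eps r x c -> K y -> vnorm d (vsub y x) <= r ->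
    chain_cost d K f F eps r y
      (c + dotd d (F x) (vsub y x) + eps * vnorm d (vsub y x)).

(* Cut a chain into pieces: a piece starting at [p], within [rho] of the centre [z] of
   one of finitely many covering balls, ends once its length [l] reaches [rho]. On a
   complete piece the error of the first-order expansion at [z] is at most
   [4 rho eps / 8 <= eps l / 2], which the surplus [eps] per unit length absorbs; only
   the last, incomplete, piece is not paid for. *)
Lemma chain_cost_lower (d : nat) (K : pt -> Prop) (f : pt -> R) (F : pt -> pt) (eps : R) :
  compactRd d K -> is_cont_deriv d K f F -> 0 < eps ->
  exists r, 0 < r /\ forall r' x c, r' <= r ->
    chain_cost d K f F eps r' x c -> f x - eps <= c.
Proof.
  intros HK [HF Hf] He.
  (* The radius [3 * rho] leaves room for a start within [rho] of [z], a piece shorter than [rho],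
     and one further step of length at most [r <= rho]. The bound [rho <= 1] limits the loss on the
     last piece. *)
  destruct (compact_cover d K (fun z rho => rho <= 1 /\ forall y, K y -> vnorm d (vsub y z) < 3 * rho ->
     vnorm d (vsub (F y) (F z)) <= eps / 2 /\
     Rabs (f y - f z - dotd d (F z) (vsub y z)) <= eps / 8 * vnorm d (vsub y z)) HK)
    as (r & Hr & Hcov).
  - intros z Kz. destruct (HF z Kz (eps / 2)) as (d1 & Hd1 & H1); [lra|].
    destruct (Hf z Kz (eps / 8)) as (d2 & Hd2 & H2); [lra|].
    assert (M1 := Rmin_l 1 (Rmin d1 d2 / 3)). assert (M2 := Rmin_r 1 (Rmin d1 d2 / 3)).
    assert (M3 := Rmin_l d1 d2). assert (M4 := Rmin_r d1 d2).
    assert (M5 := Rmin_pos d1 d2 Hd1 Hd2).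
    exists (Rmin 1 (Rmin d1 d2 / 3)).
    split; [apply Rmin_pos; lra|]. split; [lra|]. intros y Ky Hy. split.
    + apply Rlt_le, H1; auto; lra.
    (* The expansion hypothesis excludes [y = z], so the centre is treated apart. *)
    + destruct (vnorm_nonneg d (vsub y z)) as [P|Z0]; [apply H2; auto; lra|].
      destruct HK as [HK _].
      rewrite (vnorm_vsub_eq0 d y z (HK y Ky) (HK z Kz) (eq_sym Z0)).
      rewrite vnorm_vsub_diag. unfold dotd. rewrite sumd_eq0.
      * rewrite Rminus_diag, Rminus_0_r, Rabs_R0; lra.
      * intros; unfold vsub; ring.
  - assert (Hexp : forall z rho p y, K p -> K y ->
      (forall y, K y -> vnorm d (vsub y z) < 3 * rho ->
       vnorm d (vsub (F y) (F z)) <= eps / 2 /\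
       Rabs (f y - f z - dotd d (F z) (vsub y z)) <= eps / 8 * vnorm d (vsub y z)) ->
      vnorm d (vsub p z) < rho -> vnorm d (vsub y z) < 3 * rho ->
      f y - f p <= dotd d (F z) (vsub y p) + eps / 2 * rho).
    { intros z rho p y Kp Ky Hz Hp Hy.
      assert (N := vnorm_nonneg d (vsub p z)).
      destruct (Hz p Kp) as [_ Ep]; [lra|]. destruct (Hz y Ky Hy) as [_ Ey].
      assert (A1 := Rle_abs (f y - f z - dotd d (F z) (vsub y z))).
      assert (A2 := Rle_abs (- (f p - f z - dotd d (F z) (vsub p z)))).
      rewrite Rabs_Ropp in A2.
      rewrite (dotd_vsub_r d (F z) y z p), (dotd_vsub_opp d (F z) z p). nra. }
    exists r; split; auto.
    intros r' x c Hr' Hc.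
    (* Invariant along the chain, for the current piece from [p] to [x] of length [l]. Half of the
       surplus [eps] pays for replacing [F x] by [F z] in each step; the other half is saved as
       [eps / 2 * l] and pays for the expansion error when the piece is closed. *)
    assert (K x /\ exists z rho p l, K p /\ rho <= 1 /\ r <= rho /\
      (forall y, K y -> vnorm d (vsub y z) < 3 * rho ->
       vnorm d (vsub (F y) (F z)) <= eps / 2 /\
       Rabs (f y - f z - dotd d (F z) (vsub y z)) <= eps / 8 * vnorm d (vsub y z)) /\
      vnorm d (vsub p z) < rho /\ vnorm d (vsub x p) <= l /\ l < rho /\
      f p + dotd d (F z) (vsub x p) + eps / 2 * l <= c)
      as (Kx & z & rho & p & l & Kp & Hrho & Hle & Hz & Hp & Hxp & Hl & Hcost).
    { induction Hc as [x Kx|x y c Hc (Kx & z & rho & p & l & Kp & Hrho & Hle & Hz & Hp & Hxp & Hl & Hcost) Ky Hstep].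
      - split; auto. destruct (Hcov x Kx) as (z & rho & Kz & [Hrho Hz] & Hle & Hxz).
        exists z, rho, x, 0. repeat (split; auto; try lra).
        + rewrite vnorm_vsub_diag; lra.
        + unfold dotd. rewrite sumd_eq0; [lra|]. intros; unfold vsub; ring.
      - split; auto.
        assert (T1 := vnorm_triangle d x p z). assert (T2 := vnorm_triangle d y x z).
        assert (T3 := vnorm_triangle d y x p).
        assert (N := vnorm_nonneg d (vsub y x)).
        destruct (Hz x Kx) as [HFx _]; [lra|].
        assert (CS := cauchy_schwarz d (vsub (F x) (F z)) (vsub y x)).
        rewrite dotd_vsub_l in CS.
        assert (A := Rle_abs (- (dotd d (F x) (vsub y x) - dotd d (F z) (vsub y x)))).
        rewrite Rabs_Ropp in A.
        assert (Hnew : f p + dotd d (F z) (vsub y p) + eps / 2 * (l + vnorm d (vsub y x))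
          <= c + dotd d (F x) (vsub y x) + eps * vnorm d (vsub y x)).
        { rewrite (dotd_vsub_r d (F z) y x p). nra. }
        destruct (Rlt_le_dec (l + vnorm d (vsub y x)) rho) as [Hlt|Hge].
        + exists z, rho, p, (l + vnorm d (vsub y x)). repeat (split; auto; try lra).
        + destruct (Hcov y Ky) as (z' & rho' & Kz' & [Hrho' Hz'] & Hle' & Hyz').
          exists z', rho', y, 0. repeat (split; auto; try lra).
          * rewrite vnorm_vsub_diag; lra.
          * replace (dotd d (F z') (vsub y y)) with 0
              by (unfold dotd; rewrite sumd_eq0; [lra|]; intros; unfold vsub; ring).
            assert (E := Hexp z rho p y Kp Ky Hz Hp ltac:(lra)). nra. }
    assert (T := vnorm_triangle d x p z).
    assert (N := vnorm_nonneg d (vsub x p)).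
    assert (E := Hexp z rho p x Kp Kx Hz Hp ltac:(lra)). nra.
Qed.

(** Here [u] is the infimum of chain costs. Appending one step gives the upper half of the
    expansion; the lower half is the upper one with [x] and [y] exchanged, after replacing [F y] by
    [F x] at a cost of [eps / 2] per unit length. *)
Lemma uniform_first_order_approx (d : nat) (K : pt -> Prop) (f : pt -> R) (F : pt -> pt) (eps : R) :
  compactRd d K -> is_cont_deriv d K f F -> 0 < eps ->
  exists (u : pt -> R) (r : R), 0 < r <= 1 /\
    (forall x, K x -> Rabs (u x - f x) <= eps) /\
    (forall x y, K x -> K y -> vnorm d (vsub y x) <= r ->
       vnorm d (vsub (F y) (F x)) <= eps /\
       Rabs (u y - u x - dotd d (F x) (vsub y x)) <= eps * vnorm d (vsub y x)).
Proof.
  intros HK Hf He.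
  destruct (chain_cost_lower d K f F (eps / 2) HK Hf) as (r1 & Hr1 & Hlow); [lra|].
  destruct (compact_contV_uniform d K F (eps / 2) HK (proj1 Hf)) as (r2 & Hr2 & Huc); [lra|].
  (* Halving [r2] meets the strict inequality in [Huc] even for steps of length exactly [r]. *)
  set (r := Rmin 1 (Rmin r1 (r2 / 2))).
  assert (M1 := Rmin_l 1 (Rmin r1 (r2 / 2))). assert (M2 := Rmin_r 1 (Rmin r1 (r2 / 2))).
  assert (M3 := Rmin_l r1 (r2 / 2)). assert (M4 := Rmin_r r1 (r2 / 2)).
  assert (Hr : 0 < r) by (repeat apply Rmin_pos; lra).
  fold r in M1, M2.
  set (cost := chain_cost d K f F (eps / 2) r).
  (* The infimum is a negated supremum: [Hlow] bounds the costs below, and the one-point chain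
     provides a cost. Outside [K] the value is arbitrary. *)
  assert (Hglb : forall x, exists m, K x ->
    (forall c, cost x c -> m <= c) /\ (forall b, (forall c, cost x c -> b <= c) -> b <= m)).
  { intros x. destruct (excluded_middle_informative (K x)) as [Kx|]; [|now exists 0].
    destruct (completeness (fun c => cost x (- c))) as [m [Hub Hlub]].
    - exists (- (f x - eps / 2)). intros c Hc.
      assert (L := Hlow r x (- c) ltac:(lra) Hc). lra.
    - exists (- f x). rewrite Ropp_involutive. now apply chain_start.
    - exists (- m). intros _; split.
      + intros c Hc. assert (- c <= m) by (apply Hub; now rewrite Ropp_involutive). lra.
      + intros b Hb. assert (m <= - b); [|lra].
        apply Hlub. intros c Hc. apply Hb in Hc. lra. }
  set (u := fun x => proj1_sig (constructive_indefinite_description _ (Hglb x))).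
  assert (Hu : forall x, K x ->
    (forall c, cost x c -> u x <= c) /\ (forall b, (forall c, cost x c -> b <= c) -> b <= u x))
    by (intros x; exact (proj2_sig (constructive_indefinite_description _ (Hglb x)))).
  assert (Hstep : forall x y, K x -> K y -> vnorm d (vsub y x) <= r ->
    u y <= u x + dotd d (F x) (vsub y x) + eps / 2 * vnorm d (vsub y x)).
  { intros x y Kx Ky Hxy.
    enough (u y - dotd d (F x) (vsub y x) - eps / 2 * vnorm d (vsub y x) <= u x) by lra.
    apply Hu; auto. intros c Hc.
    assert (u y <= c + dotd d (F x) (vsub y x) + eps / 2 * vnorm d (vsub y x)); [|lra].
    apply Hu; auto. now apply chain_step. }
  exists u, r. split; [lra|]. split.
  - intros x Kx. apply Rabs_le. split.
    + enough (f x - eps / 2 <= u x) by lra.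
      apply Hu; auto. intros c Hc. apply (Hlow r); auto; lra.
    + enough (u x <= f x) by lra. apply Hu; auto. now apply chain_start.
  - intros x y Kx Ky Hxy.
    assert (HF : vnorm d (vsub (F y) (F x)) <= eps / 2) by (apply Huc; auto; lra).
    split; [lra|].
    assert (S1 := Hstep x y Kx Ky Hxy).
    assert (S2 := Hstep y x Ky Kx). rewrite (vnorm_vsub_sym d x y) in S2.
    specialize (S2 Hxy). rewrite (dotd_vsub_opp d (F y) x y) in S2.
    assert (CS := cauchy_schwarz d (vsub (F y) (F x)) (vsub y x)).
    rewrite dotd_vsub_l in CS.
    assert (A := Rle_abs (- (dotd d (F y) (vsub y x) - dotd d (F x) (vsub y x)))).
    rewrite Rabs_Ropp in A.
    assert (N := vnorm_nonneg d (vsub y x)).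
    apply Rabs_le. split; nra.
Qed.

(** * Smooth expressions *)

(* The family [x^-k e^(-1/x)] (extended by [0] to [x <= 0]) is closed under
   differentiation up to linear combinations. *)
Definition flat (k : nat) (x : R) : R :=
  if Rlt_dec 0 x then (/ x) ^ k * exp (- / x) else 0.

Lemma flat_pos_eq (k : nat) (x : R) : 0 < x -> flat k x = (/ x) ^ k * exp (- / x).
Proof. unfold flat; intros; destruct (Rlt_dec 0 x); [reflexivity|lra]. Qed.

Lemma flat_nonpos_eq (k : nat) (x : R) : x <= 0 -> flat k x = 0.
Proof. unfold flat; intros; destruct (Rlt_dec 0 x); [lra|reflexivity]. Qed.

Lemma flat_pos (k : nat) (x : R) : 0 < x -> 0 < flat k x.
Proof.
  intros Hx. rewrite flat_pos_eq by auto. apply Rmult_lt_0_compat; [|apply exp_pos].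
  now apply pow_lt, Rinv_0_lt_compat.
Qed.

Lemma flat_nonneg (k : nat) (x : R) : 0 <= flat k x.
Proof.
  destruct (Rlt_le_dec 0 x); [now apply Rlt_le, flat_pos|].
  rewrite flat_nonpos_eq; lra.
Qed.

Lemma exp_pow (x : R) (n : nat) : exp x ^ n = exp (INR n * x).
Proof.
  induction n as [|n IH]; [simpl; now rewrite Rmult_0_l, exp_0|].
  rewrite S_INR. simpl pow. rewrite IH, <- exp_plus. f_equal; ring.
Qed.

(* [e^y = (e^(y/n))^n >= (y/n)^n] with [y = 1/x] and [n = k+1]. *)
Lemma flat_le_linear (k : nat) (x : R) : 0 < x -> flat k x <= INR (S k) ^ S k * x.
Proof.
  intros Hx. rewrite flat_pos_eq by auto.
  set (n := INR (S k)). assert (Hn : 0 < n) by (apply lt_0_INR; lia).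
  set (y := / x). assert (Hy : 0 < y) by now apply Rinv_0_lt_compat.
  replace x with (/ y) by (unfold y; now rewrite Rinv_inv).
  assert (E : (y / n) ^ S k <= exp y).
  { replace (exp y) with (exp (y / n) ^ S k).
    - apply pow_incr. assert (0 < y / n) by now apply Rdiv_lt_0_compat.
      assert (I := exp_ineq1 (y / n) ltac:(lra)). lra.
    - rewrite exp_pow. fold n. f_equal. field. lra. }
  rewrite exp_Ropp.
  assert (Ey := exp_pos y).
  assert (Pn : 0 < n ^ S k) by now apply pow_lt.
  apply Rmult_le_reg_r with (exp y * y); [now apply Rmult_lt_0_compat|].
  replace (y ^ k * / exp y * (exp y * y)) with (n ^ S k * (y / n) ^ S k).
  - replace (n ^ S k * / y * (exp y * y)) with (n ^ S k * exp y) by (field; lra).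
    apply Rmult_le_compat_l; lra.
  - unfold Rdiv. rewrite Rpow_mult_distr, pow_inv. simpl pow in *. field.
    repeat split; try lra. apply Rgt_not_eq. simpl in Pn. now apply pow_lt.
Qed.

(** Only [x = 0] is delicate: there the difference quotient at [h > 0] is [flat (S k) h], which is
    at most a multiple of [h]. *)
Lemma flat_deriv (k : nat) (x : R) :
  derivable_pt_lim (flat k) x (flat (k + 2) x - INR k * flat (k + 1) x).
Proof.
  destruct (Rtotal_order x 0) as [Hx|[->|Hx]].
  - rewrite !flat_nonpos_eq by lra. rewrite Rmult_0_r, Rminus_0_r.
    apply (derivable_pt_lim_locally_ext (fun _ => 0) _ x (x - 1) 0); [lra| |apply derivable_pt_lim_const].
    intros z Hz. rewrite flat_nonpos_eq; lra.
  - rewrite !flat_nonpos_eq by lra. intros eps He.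
    set (C := INR (S (S k)) ^ S (S k)).
    assert (HC : 0 < C) by (apply pow_lt, lt_0_INR; lia).
    exists (mkposreal (eps / C) (Rdiv_lt_0_compat _ _ He HC)).
    intros h Hh Hlt. simpl in Hlt. rewrite Rplus_0_l, Rmult_0_r, !Rminus_0_r, (flat_nonpos_eq k 0), Rminus_0_r by lra.
    destruct (Rlt_le_dec 0 h) as [Hp|Hn].
    + replace (flat k h / h) with (flat (S k) h)
        by (rewrite !flat_pos_eq by auto; simpl; field; lra).
      rewrite Rabs_right by (apply Rle_ge, flat_nonneg).
      rewrite Rabs_right in Hlt by lra.
      assert (L := flat_le_linear (S k) h Hp). fold C in L.
      apply Rle_lt_trans with (1 := L).
      apply Rmult_lt_reg_r with (/ C); [now apply Rinv_0_lt_compat|].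
      replace (C * h * / C) with h by (field; lra). exact Hlt.
    + rewrite flat_nonpos_eq by auto. unfold Rdiv. rewrite Rmult_0_l, Rabs_R0. auto.
  - apply (derivable_pt_lim_locally_ext (fun z => (/ z) ^ k * exp (- / z)) _ x 0 (x + 1)); [lra| |].
    { intros z Hz. now rewrite flat_pos_eq. }
    rewrite !flat_pos_eq by auto.
    assert (Hinv : derivable_pt_lim (fun z => / z) x (- (/ x) ^ 2)).
    { apply (derivable_pt_lim_ext (fun z => 1 / z)); [intros; unfold Rdiv; ring|].
      replace (- (/ x) ^ 2) with ((0 * x - 1 * 1) / Rsqr x) by (unfold Rsqr; field; lra).
      apply (derivable_pt_lim_div (fun _ => 1) (fun z => z)); [apply derivable_pt_lim_const|apply derivable_pt_lim_id|lra]. }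
    assert (Hpow : derivable_pt_lim (fun z => (/ z) ^ k) x (INR k * (/ x) ^ pred k * - (/ x) ^ 2))
      by apply (derivable_pt_lim_comp (fun z => / z) (fun y => y ^ k) _ _ _ Hinv (derivable_pt_lim_pow _ _)).
    assert (Hexp : derivable_pt_lim (fun z => exp (- / z)) x (exp (- / x) * - - (/ x) ^ 2)).
    { apply (derivable_pt_lim_comp (fun z => - / z) exp); [|apply derivable_pt_lim_exp].
      apply (derivable_pt_lim_opp (fun z => / z)); exact Hinv. }
    replace ((/ x) ^ (k + 2) * exp (- / x) - INR k * ((/ x) ^ (k + 1) * exp (- / x)))
      with (INR k * (/ x) ^ pred k * - (/ x) ^ 2 * exp (- / x)
            + (/ x) ^ k * (exp (- / x) * - - (/ x) ^ 2)).
    + exact (derivable_pt_lim_mult _ _ _ _ _ Hpow Hexp).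
    + destruct k as [|k]; [simpl; ring|].
      rewrite !pow_add. simpl pred. simpl pow. ring.
Qed.

(** Denominator of the standard smooth step; it never vanishes because [t] and [1 - t] are not both
    nonpositive. *)
Definition step_den (t : R) : R := flat 0 t + flat 0 (1 - t).

Lemma step_den_pos (t : R) : 0 < step_den t.
Proof.
  unfold step_den.
  assert (H1 := flat_nonneg 0 t). assert (H2 := flat_nonneg 0 (1 - t)).
  destruct (Rlt_le_dec 0 t) as [H|H].
  - assert (H3 := flat_pos 0 t H). lra.
  - assert (H3 := flat_pos 0 (1 - t) ltac:(lra)). lra.
Qed.

Lemma step_den_inv_deriv (k : nat) (t : R) :
  derivable_pt_lim (fun t => (/ step_den t) ^ k) t
    (- INR k * (/ step_den t) ^ (k + 1) * (flat 2 t - flat 2 (1 - t))).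
Proof.
  assert (Hd := step_den_pos t).
  assert (D1 : derivable_pt_lim step_den t (flat 2 t - flat 2 (1 - t))).
  { replace (flat 2 t - flat 2 (1 - t))
      with ((flat (0 + 2) t - INR 0 * flat (0 + 1) t)
            + (flat (0 + 2) (1 - t) - INR 0 * flat (0 + 1) (1 - t)) * (0 - 1)) by (simpl; ring).
    apply (derivable_pt_lim_plus (flat 0) (fun t => flat 0 (1 - t))); [apply flat_deriv|].
    apply (derivable_pt_lim_comp (fun t => 1 - t) (flat 0)); [|apply flat_deriv].
    apply (derivable_pt_lim_minus (fun _ => 1) (fun t => t));
      [apply derivable_pt_lim_const|apply derivable_pt_lim_id]. }
  assert (D2 : derivable_pt_lim (fun t => / step_den t) t
                 (- (/ step_den t) ^ 2 * (flat 2 t - flat 2 (1 - t)))).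
  { apply (derivable_pt_lim_ext (fun z => 1 / step_den z)); [intros; unfold Rdiv; ring|].
    replace (- (/ step_den t) ^ 2 * (flat 2 t - flat 2 (1 - t)))
      with ((0 * step_den t - (flat 2 t - flat 2 (1 - t)) * 1) / Rsqr (step_den t))
      by (unfold Rsqr; field; lra).
    apply (derivable_pt_lim_div (fun _ => 1) step_den); [apply derivable_pt_lim_const|exact D1|lra]. }
  replace (- INR k * (/ step_den t) ^ (k + 1) * (flat 2 t - flat 2 (1 - t)))
    with (INR k * (/ step_den t) ^ pred k * (- (/ step_den t) ^ 2 * (flat 2 t - flat 2 (1 - t)))).
  - exact (derivable_pt_lim_comp (fun t => / step_den t) (fun y => y ^ k) _ _ _ D2 (derivable_pt_lim_pow _ _)).
  - destruct k as [|k]; [simpl; ring|]. rewrite !pow_add. simpl pred. simpl pow. ring.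
Qed.

(* Symbolic expressions, so that iterated partial derivatives of all orders are obtained
   by iterating [diff]. *)
Inductive expr : Type :=
| Cst (c : R)
| Var (i : nat)
| Add (e1 e2 : expr)
| Mul (e1 e2 : expr)
| Flat (k : nat) (e : expr)
| DenInv (k : nat) (e : expr).

Fixpoint eval (e : expr) (x : pt) : R :=
  match e with
  | Cst c => c
  | Var i => x i
  | Add e1 e2 => eval e1 x + eval e2 x
  | Mul e1 e2 => eval e1 x * eval e2 x
  | Flat k e => flat k (eval e x)
  | DenInv k e => (/ step_den (eval e x)) ^ k
  end.

Definition Sub (e1 e2 : expr) : expr := Add e1 (Mul (Cst (-1)) e2).

(** Derivative in a constant direction [v]: basis vectors give the partial derivatives, and a
    general [v] gives derivatives along segments. *)
Fixpoint diff (v : pt) (e : expr) : expr :=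
  match e with
  | Cst _ => Cst 0
  | Var i => Cst (v i)
  | Add e1 e2 => Add (diff v e1) (diff v e2)
  | Mul e1 e2 => Add (Mul (diff v e1) e2) (Mul e1 (diff v e2))
  | Flat k e =>
      Mul (Sub (Flat (k + 2) e) (Mul (Cst (INR k)) (Flat (k + 1) e))) (diff v e)
  | DenInv k e =>
      Mul (Mul (Mul (Cst (- INR k)) (DenInv (k + 1) e))
               (Sub (Flat 2 e) (Flat 2 (Sub (Cst 1) e)))) (diff v e)
  end.

(** The chain rule along a curve with velocity [v] at time [t]. It serves coordinate lines, segments
    and the diagonal curve alike. *)
Lemma eval_curve_deriv (g : R -> pt) (v : pt) (t : R) (e : expr) :
  (forall i, derivable_pt_lim (fun s => g s i) t (v i)) ->
  derivable_pt_lim (fun s => eval e (g s)) t (eval (diff v e) (g t)).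
Proof.
  intros Hg. induction e as [c|i|e1 IH1 e2 IH2|e1 IH1 e2 IH2|k e IH|k e IH]; simpl.
  - apply derivable_pt_lim_const.
  - apply Hg.
  - exact (derivable_pt_lim_plus _ _ _ _ _ IH1 IH2).
  - exact (derivable_pt_lim_mult _ _ _ _ _ IH1 IH2).
  - replace (flat (k + 2) (eval e (g t)) + -1 * (INR k * flat (k + 1) (eval e (g t))))
      with (flat (k + 2) (eval e (g t)) - INR k * flat (k + 1) (eval e (g t))) by ring.
    exact (derivable_pt_lim_comp (fun s => eval e (g s)) (flat k) _ _ _ IH (flat_deriv _ _)).
  - replace (flat 2 (eval e (g t)) + -1 * flat 2 (1 + -1 * eval e (g t)))
      with (flat 2 (eval e (g t)) - flat 2 (1 - eval e (g t)))
      by (replace (1 + -1 * eval e (g t)) with (1 - eval e (g t)) by ring; ring).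
    exact (derivable_pt_lim_comp (fun s => eval e (g s)) (fun y => (/ step_den y) ^ k) _ _ _ IH
             (step_den_inv_deriv _ _)).
Qed.

(** Differentiability of [g] is only a source of continuity, so that the derivative lemmas can be
    reused. *)
Lemma contR_on_comp (d : nat) (A : pt -> Prop) (g : R -> R) (h : pt -> R) :
  (forall t, exists l, derivable_pt_lim g t l) -> contR_on d A h ->
  contR_on d A (fun x => g (h x)).
Proof.
  intros Hg Hh x Ax eps He.
  destruct (Hg (h x)) as [l Hl].
  assert (Hc : continuity_pt g (h x)) by (apply derivable_continuous_pt; now exists l).
  destruct (Hc eps He) as (alp & Halp & Hcont).
  destruct (Hh x Ax alp Halp) as (del & Hdel & H).
  exists del; split; auto. intros y Ay Hy.
  (* The limit in [continuity_pt] is taken over points different from [h x]. *)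
  destruct (Req_dec (h x) (h y)) as [->|N]; [rewrite Rminus_diag, Rabs_R0; auto|].
  apply (Hcont (h y)). split; [split; [exact I|exact N]|]. apply (H y Ay Hy).
Qed.

Lemma contR_on_plus (d : nat) (A : pt -> Prop) (g h : pt -> R) :
  contR_on d A g -> contR_on d A h -> contR_on d A (fun x => g x + h x).
Proof.
  intros Hg Hh x Ax eps He.
  destruct (Hg x Ax (eps / 2)) as (d1 & Hd1 & H1); [lra|].
  destruct (Hh x Ax (eps / 2)) as (d2 & Hd2 & H2); [lra|].
  exists (Rmin d1 d2); split; [now apply Rmin_pos|]. intros y Ay Hy.
  assert (M1 := Rmin_l d1 d2). assert (M2 := Rmin_r d1 d2).
  specialize (H1 y Ay ltac:(lra)). specialize (H2 y Ay ltac:(lra)).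
  replace (g y + h y - (g x + h x)) with ((g y - g x) + (h y - h x)) by ring.
  assert (T := Rabs_triang (g y - g x) (h y - h x)). lra.
Qed.

(* By polarization, [g h = ((g + h)^2 - (g - h)^2) / 4]. *)
Lemma contR_on_mult (d : nat) (A : pt -> Prop) (g h : pt -> R) :
  contR_on d A g -> contR_on d A h -> contR_on d A (fun x => g x * h x).
Proof.
  intros Hg Hh.
  assert (Hlin : forall c (k : pt -> R), contR_on d A k -> contR_on d A (fun x => c * k x)).
  { intros c k. apply (contR_on_comp d A (fun t => c * t)). intros t. exists (c * 1).
    apply (derivable_pt_lim_scal (fun t => t)), derivable_pt_lim_id. }
  assert (Hsq : forall (k : pt -> R), contR_on d A k -> contR_on d A (fun x => k x ^ 2)).
  { intros k. apply (contR_on_comp d A (fun t => t ^ 2)). intros t.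
    eexists; apply derivable_pt_lim_pow. }
  assert (H := contR_on_plus d A _ _
     (Hlin (/ 4) _ (Hsq _ (contR_on_plus d A _ _ Hg Hh)))
     (Hlin (- / 4) _ (Hsq _ (contR_on_plus d A _ _ Hg (Hlin (-1) _ Hh))))).
  intros x Ax eps He. destruct (H x Ax eps He) as (del & Hdel & Hd).
  exists del; split; auto. intros y Ay Hy. specialize (Hd y Ay Hy).
  match type of Hd with Rabs ?a < _ => replace (g y * h y - g x * h x) with a by field end.
  exact Hd.
Qed.

Lemma eval_continuous (d : nat) (e : expr) : contR_on d (inRd d) (eval e).
Proof.
  induction e as [c|i|e1 IH1 e2 IH2|e1 IH1 e2 IH2|k e IH|k e IH]; simpl.
  - intros x _ eps He. exists 1; split; [lra|]. intros. rewrite Rminus_diag, Rabs_R0. auto.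
  - intros x Hx eps He. exists eps; split; auto. intros y Hy Hxy.
    destruct (Nat.lt_ge_cases i d) as [Hi|Hi].
    + apply Rle_lt_trans with (2 := Hxy). now apply (coord_le_vnorm d (vsub y x)).
    + rewrite Hx, Hy, Rminus_diag, Rabs_R0; auto.
  - now apply contR_on_plus.
  - now apply contR_on_mult.
  - apply (contR_on_comp d _ (flat k)); auto. intros t. eexists; apply flat_deriv.
  - apply (contR_on_comp d _ (fun t => (/ step_den t) ^ k)); auto.
    intros t. eexists; apply step_den_inv_deriv.
Qed.

Definition basis (i : nat) : pt := fun j => if Nat.eqb j i then 1 else 0.

Definition diffs (a : list nat) (e : expr) : expr :=
  fold_right (fun i e => diff (basis i) e) e a.

Lemma eval_smooth (d : nat) (e : expr) :
  smooth_family d (eval e) (fun a => eval (diffs a e)).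
Proof.
  split; [reflexivity|]. intros a _. split; [apply eval_continuous|].
  intros i _ x _. simpl.
  replace (eval (diff (basis i) (diffs a e)) x)
    with (eval (diff (basis i) (diffs a e)) (upd x i (x i))).
  - apply eval_curve_deriv. intros j. unfold upd, basis.
    destruct (Nat.eqb j i); [apply derivable_pt_lim_id|apply derivable_pt_lim_const].
  - f_equal. apply functional_extensionality; intros j.
    unfold upd. now destruct (Nat.eqb_spec j i) as [->|].
Qed.

(** Expresses a directional derivative through the gradient. Variables of index at least [d]
    contribute nothing because [v] vanishes there. *)
Lemma eval_diff_linear (d : nat) (v : pt) (e : expr) (x : pt) : inRd d v ->
  eval (diff v e) x = sumd d (fun i => eval (diff (basis i) e) x * v i).
Proof.
  intros Hv. induction e as [c|i|e1 IH1 e2 IH2|e1 IH1 e2 IH2|k e IH|k e IH]; simpl.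
  - symmetry; apply sumd_eq0; intros; ring.
  - destruct (Nat.lt_ge_cases i d) as [Hi|Hi].
    + rewrite (sumd_single d _ i Hi); unfold basis.
      * rewrite Nat.eqb_refl; ring.
      * intros j Hj. destruct (Nat.eqb_spec i j); [congruence|ring].
    + rewrite Hv by auto. symmetry; apply sumd_eq0. intros j Hj. unfold basis.
      destruct (Nat.eqb_spec i j); [lia|ring].
  - rewrite IH1, IH2, <- sumd_plus. apply sumd_ext; intros; ring.
  - rewrite IH1, IH2, Rmult_comm, <- !sumd_scal, <- sumd_plus. apply sumd_ext; intros; ring.
  - rewrite IH, <- sumd_scal. apply sumd_ext; intros; ring.
  - rewrite IH, <- sumd_scal. apply sumd_ext; intros; ring.
Qed.

Lemma contV_on_coord (d : nat) (A : pt -> Prop) (v : pt -> pt) :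
  (forall i, (i < d)%nat -> contR_on d A (fun x => v x i)) -> contV_on d A v.
Proof.
  intros H x Ax eps He.
  assert (Hd := pos_INR d).
  (* Adding [1] covers [d = 0] and makes [INR d * eta < eps] strict. *)
  set (eta := eps / (INR d + 1)).
  assert (Heta : 0 < eta) by (apply Rdiv_lt_0_compat; lra).
  assert (exists del, 0 < del /\ forall y, A y -> vnorm d (vsub y x) < del ->
    forall i, (i < d)%nat -> Rabs (v y i - v x i) < eta) as (del & Hdel & Hy).
  { enough (forall n, (n <= d)%nat -> exists del, 0 < del /\ forall y, A y -> vnorm d (vsub y x) < del ->
    forall i, (i < n)%nat -> Rabs (v y i - v x i) < eta) by auto.
    induction n as [|n IH]; intros Hn.
    - exists 1; split; [lra|]. intros; lia.
    - destruct IH as (d1 & Hd1 & H1); [lia|].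
      destruct (H n Hn x Ax eta Heta) as (d2 & Hd2 & H2).
      assert (M1 := Rmin_l d1 d2). assert (M2 := Rmin_r d1 d2).
      exists (Rmin d1 d2); split; [now apply Rmin_pos|]. intros y Ay Hy i Hi.
      destruct (Nat.eq_dec i n) as [->|].
      + apply H2; auto; lra.
      + apply H1; auto; [lra|lia]. }
  exists del; split; auto. intros y Ay Hyx.
  apply Rle_lt_trans with (INR d * eta).
  - apply vnorm_le_coord; [lra|]. intros i Hi. apply Rlt_le. now apply Hy.
  - unfold eta. apply Rmult_lt_reg_r with (INR d + 1); [lra|].
    replace (INR d * (eps / (INR d + 1)) * (INR d + 1)) with (INR d * eps) by (field; lra). nra.
Qed.

(** By the mean value theorem on the segment from [x] to [y], the increment is the gradient at an
    intermediate point paired with [y - x]; continuity of the gradient and Cauchy-Schwarz bound the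
    error. *)
Lemma eval_is_cont_deriv (d : nat) (e : expr) :
  is_cont_deriv d (inRd d) (eval e) (gradD (fun a => eval (diffs a e))).
Proof.
  assert (HG : contV_on d (inRd d) (gradD (fun a => eval (diffs a e))))
    by (apply contV_on_coord; intros; apply eval_continuous).
  split; [exact HG|].
  intros x Hx eps He.
  destruct (HG x Hx eps He) as (del & Hdel & Hc).
  exists del; split; auto. intros y Hy Hxy.
  set (v := vsub y x) in *.
  assert (Hv : inRd d v) by (intros i Hi; unfold v, vsub; rewrite Hx, Hy; auto; ring).
  set (g := fun t i => x i + t * v i).
  destruct (MVT_cor2 (fun t => eval e (g t)) (fun t => eval (diff v e) (g t)) 0 1)
    as (t & Ht & Hin); [lra| |].
  { intros t _. apply eval_curve_deriv. intros i. unfold g.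
    cut (derivable_pt_lim (fun s => x i + s * v i) t (0 + (1 * v i + t * 0)));
      [now replace (0 + (1 * v i + t * 0)) with (v i) by ring|].
    apply (derivable_pt_lim_plus (fun _ => x i) (fun s => s * v i)); [apply derivable_pt_lim_const|].
    apply (derivable_pt_lim_mult (fun s => s) (fun _ => v i));
      [apply derivable_pt_lim_id|apply derivable_pt_lim_const]. }
  replace (g 1) with y in Ht
    by (apply functional_extensionality; intros i; unfold g, v, vsub; ring).
  replace (g 0) with x in Ht
    by (apply functional_extensionality; intros i; unfold g; ring).
  rewrite Ht, Rminus_0_r, Rmult_1_r, (eval_diff_linear d v e (g t) Hv).
  change (Rabs (dotd d (gradD (fun a => eval (diffs a e)) (g t)) v
     - dotd d (gradD (fun a => eval (diffs a e)) x) v) <= eps * vnorm d v).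
  rewrite <- dotd_vsub_l.
  eapply Rle_trans; [apply cauchy_schwarz|].
  apply Rmult_le_compat_r; [apply vnorm_nonneg|]. apply Rlt_le, Hc.
  - intros i Hi. unfold g. rewrite Hx, Hv by auto. ring.
  - apply Rle_lt_trans with (vnorm d v); [|lra].
    apply vnorm_le_sqr; [apply vnorm_nonneg|]. rewrite vnorm_sqr. apply sumd_le.
    intros i _. unfold vsub, g. assert (0 <= v i ^ 2) by apply pow2_ge_0.
    replace ((x i + t * v i - x i) ^ 2) with (t ^ 2 * v i ^ 2) by ring.
    assert (t ^ 2 <= 1) by nra. nra.
Qed.

(** * Partition of unity on a grid *)

Definition step (t : R) : R := flat 0 t * / step_den t.

Definition step' (t : R) : R :=
  flat 2 t * / step_den t
  - flat 0 t * (/ step_den t) ^ 2 * (flat 2 t - flat 2 (1 - t)).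

Lemma step_le0 (t : R) : t <= 0 -> step t = 0.
Proof. intros H. unfold step. rewrite flat_nonpos_eq; lra. Qed.

Lemma step_ge1 (t : R) : 1 <= t -> step t = 1.
Proof.
  intros H. assert (P := flat_pos 0 t ltac:(lra)).
  unfold step, step_den. rewrite (flat_nonpos_eq 0 (1 - t)) by lra. field; lra.
Qed.

Lemma step_range (t : R) : 0 <= step t <= 1.
Proof.
  assert (P := step_den_pos t). assert (H1 := flat_nonneg 0 t).
  assert (H2 := flat_nonneg 0 (1 - t)).
  unfold step. split.
  - apply Rmult_le_pos; auto. now apply Rlt_le, Rinv_0_lt_compat.
  - apply Rmult_le_reg_r with (step_den t); auto.
    rewrite Rmult_assoc, Rinv_l by lra. unfold step_den; lra.
Qed.

Lemma step'_le0 (t : R) : t <= 0 -> step' t = 0.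
Proof. intros H. unfold step'. rewrite !(flat_nonpos_eq _ t) by lra. ring. Qed.

Lemma step'_ge1 (t : R) : 1 <= t -> step' t = 0.
Proof.
  intros H. assert (P := flat_pos 0 t ltac:(lra)).
  unfold step', step_den. rewrite !(flat_nonpos_eq _ (1 - t)) by lra. field; lra.
Qed.

Definition Step (e : expr) : expr := Mul (Flat 0 e) (DenInv 1 e).

Lemma eval_Step (e : expr) (x : pt) : eval (Step e) x = step (eval e x).
Proof. simpl. unfold step. ring. Qed.

Lemma eval_diff_Step (v : pt) (e : expr) (x : pt) :
  eval (diff v (Step e)) x = step' (eval e x) * eval (diff v e) x.
Proof.
  simpl. unfold step'. replace (1 + -1 * eval e x) with (1 - eval e x) by ring. ring.
Qed.

(** [step'] vanishes outside [[0, 1]] and is continuous because it is itself the value of an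
    expression along the diagonal curve. *)
Lemma step'_bounded : exists M, 0 <= M /\ forall t, Rabs (step' t) <= M.
Proof.
  assert (Hc : forall t, continuity_pt (fun t => Rabs (step' t)) t).
  { intros t. apply (continuity_pt_comp step' Rabs); [|apply Rcontinuity_abs].
    apply derivable_continuous_pt.
    eexists. apply (derivable_pt_lim_ext (fun s => eval (diff (basis 0) (Step (Var 0))) (fun _ => s))).
    - intros s. rewrite eval_diff_Step. simpl. unfold basis; simpl. ring.
    - apply eval_curve_deriv with (v := fun _ => 1). intros; apply derivable_pt_lim_id. }
  destruct (continuity_ab_maj (fun t => Rabs (step' t)) 0 1) as (m & Hm & _); [lra|auto|].
  exists (Rabs (step' m)). split; [apply Rabs_pos|]. intros t.
  destruct (Rlt_le_dec t 0); [rewrite (step'_le0 t), Rabs_R0; [apply Rabs_pos|lra]|].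
  destruct (Rlt_le_dec 1 t); [rewrite (step'_ge1 t), Rabs_R0; [apply Rabs_pos|lra]|].
  apply Hm; lra.
Qed.

Fixpoint SumE (n : nat) (g : nat -> expr) : expr :=
  match n with O => Cst 0 | S n => Add (SumE n g) (g n) end.

Lemma eval_SumE (n : nat) (g : nat -> expr) (x : pt) :
  eval (SumE n g) x = sumd n (fun k => eval (g k) x).
Proof. induction n as [|n IH]; simpl; [reflexivity|now rewrite IH]. Qed.

Lemma eval_diff_SumE (n : nat) (v : pt) (g : nat -> expr) (x : pt) :
  eval (diff v (SumE n g)) x = sumd n (fun k => eval (diff v (g k)) x).
Proof. induction n as [|n IH]; simpl; [reflexivity|now rewrite IH]. Qed.

(** Coordinate in units of the mesh [s], shifted by [c] so that natural numbers can index the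
    nodes. *)
Definition gcoord (s c : R) (i : nat) (x : pt) : R := / s * x i + c.

Definition GCoord (s c : R) (i : nat) : expr := Add (Mul (Cst (/ s)) (Var i)) (Cst c).

(** Differences of consecutive steps telescope, which is what makes the bumps a partition of unity;
    this one lives on grid coordinates in [[k, k + 2]]. *)
Definition Bump (s c : R) (k i : nat) : expr :=
  Sub (Step (Sub (GCoord s c i) (Cst (INR k)))) (Step (Sub (GCoord s c i) (Cst (INR (S k))))).

Lemma eval_Bump (s c : R) (k i : nat) (x : pt) :
  eval (Bump s c k i) x = step (gcoord s c i x - INR k) - step (gcoord s c i x - INR (S k)).
Proof.
  unfold Bump. cbn [eval Sub]. rewrite !eval_Step. cbn [eval Sub GCoord]. unfold gcoord.
  replace (/ s * x i + c + -1 * INR k) with (/ s * x i + c - INR k) by ring.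
  replace (/ s * x i + c + -1 * INR (S k)) with (/ s * x i + c - INR (S k)) by ring.
  ring.
Qed.

Lemma eval_diff_Bump (s c : R) (v : pt) (k i : nat) (x : pt) :
  eval (diff v (Bump s c k i)) x =
  (step' (gcoord s c i x - INR k) - step' (gcoord s c i x - INR (S k))) * (/ s * v i).
Proof.
  unfold Bump. cbn [eval Sub diff]. rewrite !eval_diff_Step. cbn [eval Sub GCoord diff]. unfold gcoord.
  replace (/ s * x i + c + -1 * INR k) with (/ s * x i + c - INR k) by ring.
  replace (/ s * x i + c + -1 * INR (S k)) with (/ s * x i + c - INR (S k)) by ring.
  ring.
Qed.

Definition updn (a : nat -> nat) (i k : nat) : nat -> nat :=
  fun j => if Nat.eqb j i then k else a j.

(* [Grid N s c n T a] blends the expressions [T b], for [b] ranging over the multi-indices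
   that agree with [a] except at positions below [n], with the tensor-product bumps. *)
Fixpoint Grid (N : nat) (s c : R) (n : nat) (T : (nat -> nat) -> expr) (a : nat -> nat) : expr :=
  match n with
  | O => T a
  | S n => SumE N (fun k => Mul (Bump s c k n) (Grid N s c n T (updn a n k)))
  end.

Lemma Bump_outside (s c : R) (k m i : nat) (x : pt) :
  INR (S m) <= gcoord s c i x <= INR (S m) + 1 -> k <> m -> k <> S m ->
  eval (Bump s c k i) x = 0 /\ forall v, eval (diff v (Bump s c k i)) x = 0.
Proof.
  rewrite S_INR. intros Ht H1 H2.
  assert ((k < m)%nat \/ (S m < k)%nat) as [H|H] by lia.
  - assert (Hk := le_INR (S k) m H).
    rewrite eval_Bump. split; [|intros v; rewrite eval_diff_Bump].
    + rewrite !step_ge1; rewrite ?S_INR in *; lra.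
    + rewrite !step'_ge1; rewrite ?S_INR in *; lra.
  - assert (Hk := le_INR (S (S m)) k H).
    rewrite eval_Bump. split; [|intros v; rewrite eval_diff_Bump].
    + rewrite !step_le0; rewrite ?S_INR in *; lra.
    + rewrite !step'_le0; rewrite ?S_INR in *; lra.
Qed.

(** In this cell the bumps [m] and [S m] equal [1 - sg] and [sg], so blending in one more coordinate
    is a convex combination. *)
Lemma eval_Grid_S (N : nat) (s c : R) (n m : nat) T a (x : pt) :
  (S m < N)%nat -> INR (S m) <= gcoord s c n x <= INR (S m) + 1 ->
  let sg := step (gcoord s c n x - INR (S m)) in
  eval (Grid N s c (S n) T a) x =
  (1 - sg) * eval (Grid N s c n T (updn a n m)) x
  + sg * eval (Grid N s c n T (updn a n (S m))) x.
Proof.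
  intros HN Ht sg. simpl Grid. rewrite eval_SumE.
  rewrite (sumd_two N _ m HN).
  - cbn [eval]. rewrite !eval_Bump. fold sg. rewrite (step_ge1 (_ - INR m)), (step_le0 (_ - INR (S (S m)))).
    + ring.
    + rewrite !S_INR in *; lra.
    + rewrite !S_INR in *; lra.
  - intros k H1 H2. cbn [eval]. destruct (Bump_outside s c k m n x Ht H1 H2) as [-> _]. ring.
Qed.

(** The two active bumps have opposite derivatives, so the large factor [/ s] multiplies only the
    difference of two neighbouring blends. *)
Lemma eval_diff_Grid_S (N : nat) (s c : R) (n m : nat) T a (v x : pt) :
  (S m < N)%nat -> INR (S m) <= gcoord s c n x <= INR (S m) + 1 ->
  let sg := step (gcoord s c n x - INR (S m)) in
  eval (diff v (Grid N s c (S n) T a)) x =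
  (1 - sg) * eval (diff v (Grid N s c n T (updn a n m))) x
  + sg * eval (diff v (Grid N s c n T (updn a n (S m)))) x
  + step' (gcoord s c n x - INR (S m)) * (/ s * v n) *
    (eval (Grid N s c n T (updn a n (S m))) x - eval (Grid N s c n T (updn a n m)) x).
Proof.
  intros HN Ht sg. simpl Grid. rewrite eval_diff_SumE.
  rewrite (sumd_two N _ m HN).
  - cbn [eval diff]. rewrite !eval_Bump, !eval_diff_Bump. fold sg.
    rewrite (step_ge1 (_ - INR m)), (step_le0 (_ - INR (S (S m)))),
      (step'_ge1 (_ - INR m)), (step'_le0 (_ - INR (S (S m)))); rewrite !S_INR in *; lra.
  - intros k H1 H2. cbn [eval diff]. destruct (Bump_outside s c k m n x Ht H1 H2) as [-> ->]. ring.
Qed.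

Lemma convex_dist (sg a b c A : R) :
  0 <= sg <= 1 -> Rabs (a - c) <= A -> Rabs (b - c) <= A ->
  Rabs ((1 - sg) * a + sg * b - c) <= A.
Proof.
  intros Hs Ha Hb.
  replace ((1 - sg) * a + sg * b - c) with ((1 - sg) * (a - c) + sg * (b - c)) by ring.
  eapply Rle_trans; [apply Rabs_triang|].
  rewrite !Rabs_mult, (Rabs_right (1 - sg)), (Rabs_right sg) by lra. nra.
Qed.

(* At a point [x] whose grid coordinates lie in the cells [m i + 1, m i + 2], only the bumps
   with indices [m i] and [m i + 1] do not vanish. *)
Definition in_cell (d N : nat) (s c : R) (m : nat -> nat) (x : pt) : Prop :=
  forall i, (i < d)%nat ->
    (S (m i) < N)%nat /\ INR (S (m i)) <= gcoord s c i x <= INR (S (m i)) + 1.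

(** Positions below [n] are unconstrained because [Grid] overwrites them. *)
Definition active (d n : nat) (m a : nat -> nat) : Prop :=
  forall i, (n <= i < d)%nat -> a i = m i \/ a i = S (m i).

Lemma active_updn (d n k : nat) (m a : nat -> nat) :
  active d (S n) m a -> k = m n \/ k = S (m n) -> active d n m (updn a n k).
Proof.
  intros Ha Hk i Hi. unfold updn. destruct (Nat.eqb_spec i n) as [->|]; auto.
  apply Ha; lia.
Qed.

Lemma Grid_value (d N : nat) (s c : R) (T : (nat -> nat) -> expr) (x : pt) (m : nat -> nat) (A y : R) :
  in_cell d N s c m x ->
  (forall a, active d 0 m a -> Rabs (eval (T a) x - y) <= A) ->
  forall n a, (n <= d)%nat -> active d n m a -> Rabs (eval (Grid N s c n T a) x - y) <= A.
Proof.
  intros Hm HT n. induction n as [|n IH]; intros a Hn Ha; [now apply HT|].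
  destruct (Hm n Hn) as [HN Ht].
  rewrite (eval_Grid_S N s c n (m n)) by auto.
  apply convex_dist; [apply step_range|apply IH|apply IH]; try lia; apply active_updn; auto.
Qed.

(** Convex combination preserves the bound [B], and each blended coordinate adds a bump-derivative
    term: at most [M * / s] times the difference of two blends that both lie within [A] of [y]. In
    the application [A] is proportional to [s], so the factor [/ s] cancels. *)
Lemma Grid_diff (d N : nat) (s c : R) (T : (nat -> nat) -> expr) (x : pt) (m : nat -> nat)
  (M A B y z : R) (v : pt) :
  0 < s -> (forall t, Rabs (step' t) <= M) -> (forall i, Rabs (v i) <= 1) ->
  in_cell d N s c m x ->
  (forall a, active d 0 m a ->
     Rabs (eval (T a) x - y) <= A /\ Rabs (eval (diff v (T a)) x - z) <= B) ->
  forall n a, (n <= d)%nat -> active d n m a ->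
  Rabs (eval (diff v (Grid N s c n T a)) x - z) <= B + INR n * (M * / s * (2 * A)).
Proof.
  intros Hs HM Hv Hm HT n.
  induction n as [|n IH]; intros a Hn Ha.
  { simpl. rewrite Rmult_0_l, Rplus_0_r. now apply HT. }
  destruct (Hm n Hn) as [HN Ht].
  rewrite (eval_diff_Grid_S N s c n (m n)) by auto.
  assert (Ha1 : active d n m (updn a n (m n))) by (apply active_updn; auto).
  assert (Ha2 : active d n m (updn a n (S (m n)))) by (apply active_updn; auto).
  assert (HV : forall b, active d 0 m b -> Rabs (eval (T b) x - y) <= A) by (intros; now apply HT).
  assert (E1 := Grid_value d N s c T x m A y Hm HV n _ ltac:(lia) Ha1).
  assert (E2 := Grid_value d N s c T x m A y Hm HV n _ ltac:(lia) Ha2).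
  assert (D1 := IH _ ltac:(lia) Ha1). assert (D2 := IH _ ltac:(lia) Ha2).
  assert (Hsg := step_range (gcoord s c n x - INR (S (m n)))).
  set (sg := step _) in *.
  set (G1 := eval (Grid N s c n T (updn a n (m n))) x) in *.
  set (G2 := eval (Grid N s c n T (updn a n (S (m n)))) x) in *.
  assert (HG : Rabs (G2 - G1) <= 2 * A).
  { replace (G2 - G1) with ((G2 - y) - (G1 - y)) by ring.
    eapply Rle_trans; [apply Rabs_triang|]. rewrite Rabs_Ropp. lra. }
  assert (Hsi : 0 < / s) by now apply Rinv_0_lt_compat.
  match goal with |- Rabs (?p + ?q - z) <= _ => set (P := p) in *; set (Q := q) in * end.
  replace (P + Q - z) with ((P - z) + Q) by ring.
  eapply Rle_trans; [apply Rabs_triang|].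
  assert (HP : Rabs (P - z) <= B + INR n * (M * / s * (2 * A))) by now apply convex_dist.
  assert (HQ : Rabs Q <= M * / s * (2 * A)).
  { unfold Q. rewrite !Rabs_mult, (Rabs_right (/ s)) by lra.
    apply Rmult_le_compat; auto using Rabs_pos.
    - repeat apply Rmult_le_pos; auto using Rabs_pos; lra.
    - apply Rmult_le_compat; auto using Rabs_pos.
      + apply Rmult_le_pos; [lra|apply Rabs_pos].
      + specialize (Hv n). assert (P0 := Rabs_pos (v n)). nra. }
  rewrite S_INR. lra.
Qed.

Lemma Grid_support (N : nat) (s c : R) (T : (nat -> nat) -> expr) (x : pt) (i : nat) :
  gcoord s c i x <= 0 \/ INR N + 1 <= gcoord s c i x ->
  forall n a, (i < n)%nat -> eval (Grid N s c n T a) x = 0.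
Proof.
  intros Ht n. induction n as [|n IH]; intros a Hn; [lia|].
  simpl Grid. rewrite eval_SumE. apply sumd_eq0. intros k Hk. cbn [eval].
  destruct (Nat.eq_dec i n) as [->|]; [|rewrite IH by lia; ring].
  rewrite eval_Bump. apply le_INR in Hk. rewrite !S_INR in *. assert (P := pos_INR k).
  destruct Ht; [rewrite !step_le0 by lra|rewrite !step_ge1 by lra]; ring.
Qed.

(** Outside the box of half-width [C] some grid coordinate leaves [(0, N + 1)], where every bump in
    that coordinate vanishes. *)
Lemma Grid_compact_support (d N : nat) (s c : R) (T : (nat -> nat) -> expr) (a : nat -> nat) :
  0 < s -> compact_support d (eval (Grid N s c d T a)).
Proof.
  intros Hs. set (C := s * (Rabs c + INR N + 1)).
  assert (HC : 0 <= C).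
  { apply Rmult_le_pos; [lra|]. assert (H := Rabs_pos c). assert (H' := pos_INR N). lra. }
  exists (INR d * C). intros x _ Hx.
  destruct (classic (exists i, (i < d)%nat /\ C < Rabs (x i))) as [(i & Hi & Hlt)|Hno].
  - apply (Grid_support N s c T x i); auto. unfold gcoord.
    assert (E : Rabs c + INR N + 1 < Rabs (/ s * x i)).
    { rewrite Rabs_mult, (Rabs_right (/ s)) by (apply Rle_ge, Rlt_le, Rinv_0_lt_compat; auto).
      apply Rmult_lt_reg_l with s; auto. fold C.
      rewrite <- Rmult_assoc, Rinv_r, Rmult_1_l by lra. exact Hlt. }
    assert (c <= Rabs c) by apply Rle_abs.
    assert (- c <= Rabs c) by (rewrite <- Rabs_Ropp; apply Rle_abs).
    assert (P := pos_INR N).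
    revert E. unfold Rabs at 2. destruct (Rcase_abs (/ s * x i)); intros; lra.
  - exfalso. apply (Rlt_not_le _ _ Hx). apply vnorm_le_coord; auto.
    intros i Hi. apply Rnot_lt_le. intros Hlt. apply Hno. now exists i.
Qed.

(** * Blending first-order expansions into a smooth approximation *)

Definition Taylor (d : nat) (y : R) (w p : pt) : expr :=
  Add (Cst y) (SumE d (fun i => Mul (Cst (w i)) (Sub (Var i) (Cst (p i))))).

Lemma eval_Taylor (d : nat) (y : R) (w p x : pt) :
  eval (Taylor d y w p) x = y + dotd d w (vsub x p).
Proof.
  unfold Taylor. cbn [eval]. rewrite eval_SumE. f_equal. apply sumd_ext.
  intros i _. simpl. unfold vsub. ring.
Qed.

Lemma eval_diff_Taylor (d : nat) (y : R) (w p x : pt) (i : nat) :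
  (i < d)%nat -> eval (diff (basis i) (Taylor d y w p)) x = w i.
Proof.
  intros Hi. unfold Taylor. cbn [eval diff]. rewrite eval_diff_SumE, (sumd_single d _ i Hi).
  - simpl. unfold basis. rewrite Nat.eqb_refl. ring.
  - intros j Hj. simpl. unfold basis. apply Nat.eqb_neq in Hj. rewrite Hj. ring.
Qed.

Lemma nat_floor (t : R) : 0 <= t -> exists m, INR m <= t <= INR m + 1.
Proof.
  intros Ht. destruct (archimed t) as [H1 H2].
  assert (0 <= up t - 1)%Z.
  { assert (0 < up t)%Z by (apply lt_IZR; lra). lia. }
  exists (Z.to_nat (up t - 1)). rewrite INR_IZR_INZ, Z2Nat.id, minus_IZR by auto. lra.
Qed.

(** Common source of both density claims. For each node [a] close to [K] a point [p a] of [K] is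
    chosen, and the first-order expansions of [u] at these points are blended over the grid. *)
Lemma smooth_approximation (d : nat) (K : pt -> Prop) (f : pt -> R) (F : pt -> pt) :
  compactRd d K -> is_cont_deriv d K f F -> forall eps, 0 < eps ->
  exists e : expr, compact_support d (eval e) /\
    exists a b, a + b < eps /\
      (forall x, K x -> Rabs (f x - eval e x) <= a) /\
      (forall x, K x -> vnorm d (vsub (F x) (gradD (fun l => eval (diffs l e)) x)) <= b).
Proof.
  intros HK Hf eps He.
  destruct step'_bounded as (M & HM0 & HM).
  assert (Hd := pos_INR d).
  (* Gradient error per coordinate in units of [eta]: [1] from the variation of [F], and
     [M / s * 2 A] with [A = 4 s d eta] from each of the [d] blended coordinates. *)
  set (Q := 1 + INR d * (M * (8 * INR d))).
  assert (HQ : 1 <= Q).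
  { unfold Q. assert (0 <= INR d * (M * (8 * INR d))); [|lra].
    repeat apply Rmult_le_pos; auto; lra. }
  (* The errors total [2 eta + d Q eta]; the third [eta] makes the final inequality strict. *)
  set (eta := eps / (3 + INR d * Q)).
  assert (HdQ : 0 <= INR d * Q) by (apply Rmult_le_pos; lra).
  assert (Heta : 0 < eta) by (apply Rdiv_lt_0_compat; lra).
  destruct (uniform_first_order_approx d K f F eta HK Hf Heta) as (u & r & Hr & Huf & Hu).
  destruct (compact_coord_bounded d K HK) as (L & HL & HKL).
  (* Two points near the same node differ by at most [4 * s] in each coordinate, so this mesh puts
     them within [r] of each other. The [1] covers [d = 0]. *)
  set (s := r / (4 * INR d + 1)).
  assert (Hs : 0 < s) by (apply Rdiv_lt_0_compat; lra).
  assert (Hsr : INR d * (4 * s) <= r).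
  { apply Rmult_le_reg_r with (4 * INR d + 1); [lra|].
    replace (INR d * (4 * s) * (4 * INR d + 1)) with (4 * INR d * r)
      by (unfold s; field; lra). nra. }
  (* With this shift the grid coordinates on [K] are at least [1]; below [1] the bumps do not sum to
     one. *)
  set (c := / s * L + 1).
  assert (Hsi : 0 < / s) by now apply Rinv_0_lt_compat.
  destruct (INR_unbounded (2 * (/ s * L) + 1)) as [N HN].
  (* If [a] is active at [x], then [a i] is [m i] or [m i + 1] while the grid coordinate lies in
     [[m i + 1, m i + 2]]; hence the bound [2]. *)
  set (near := fun (a : nat -> nat) y =>
    forall i, (i < d)%nat -> Rabs (gcoord s c i y - INR (a i)) <= 2).
  (* Nodes far from [K] receive an arbitrary point; they are never active at a point of [K]. *)
  assert (Hpick : forall a, exists p, (exists y, K y /\ near a y) -> K p /\ near a p).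
  { intros a. destruct (classic (exists y, K y /\ near a y)) as [[y Hy]|Hno].
    - now exists y.
    - exists (fun _ => 0). intros Hy. contradiction. }
  set (p := fun a => proj1_sig (constructive_indefinite_description _ (Hpick a))).
  assert (Hp : forall a, (exists y, K y /\ near a y) -> K (p a) /\ near a (p a))
    by (intros a; exact (proj2_sig (constructive_indefinite_description _ (Hpick a)))).
  set (T := fun a => Taylor d (u (p a)) (F (p a)) (p a)).
  set (e := Grid N s c d T (fun _ => O)).
  set (A := eta * (INR d * (4 * s))).
  assert (HA : A <= eta) by (unfold A; nra).
  assert (Hmain : forall x, K x -> Rabs (eval e x - u x) <= A /\
    forall i, (i < d)%nat -> Rabs (eval (diff (basis i) e) x - F x i) <= eta * Q).
  { intros x Kx.
    assert (Hm : forall i, exists m, (i < d)%nat ->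
      (S m < N)%nat /\ INR (S m) <= gcoord s c i x <= INR (S m) + 1).
    { intros i. destruct (Nat.lt_ge_cases i d) as [Hi|Hi]; [|exists O; lia].
      assert (Hb := HKL x i Kx Hi).
      assert (Hb' : - L <= x i <= L) by (unfold Rabs in Hb; destruct (Rcase_abs (x i)); lra).
      assert (0 <= / s * (x i + L)) by (apply Rmult_le_pos; lra).
      assert (/ s * (x i + L) <= / s * (2 * L)) by (apply Rmult_le_compat_l; lra).
      destruct (nat_floor (/ s * (x i + L))) as [m Hm]; auto.
      exists m. intros _. rewrite S_INR. unfold gcoord, c. split; [|lra].
      apply INR_lt. rewrite S_INR. lra. }
    set (m := fun i => proj1_sig (constructive_indefinite_description _ (Hm i))).
    assert (Hm' : in_cell d N s c m x)
      by (intros i; exact (proj2_sig (constructive_indefinite_description _ (Hm i)))).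
    assert (HT : forall a, active d 0 m a ->
      Rabs (eval (T a) x - u x) <= A /\
      forall i, (i < d)%nat -> Rabs (eval (diff (basis i) (T a)) x - F x i) <= eta).
    { intros a Ha.
      assert (Hx : near a x).
      { intros i Hi. destruct (Hm' i Hi) as [_ Hi']. rewrite S_INR in Hi'.
        destruct (Ha i ltac:(lia)) as [->| ->]; apply Rabs_le; rewrite ?S_INR; lra. }
      destruct (Hp a) as [Kp Hpa]; [now exists x|].
      assert (Hdist : vnorm d (vsub x (p a)) <= INR d * (4 * s)).
      { apply vnorm_le_coord; [lra|]. intros i Hi.
        assert (N1 := Hx i Hi). assert (N2 := Hpa i Hi).
        unfold vsub.
        replace (x i - p a i) with
          (s * ((gcoord s c i x - INR (a i)) - (gcoord s c i (p a) - INR (a i))))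
          by (unfold gcoord; field; lra).
        rewrite Rabs_mult, (Rabs_right s) by lra.
        rewrite (Rmult_comm 4). apply Rmult_le_compat_l; [lra|].
        eapply Rle_trans; [apply Rabs_triang|]. rewrite Rabs_Ropp. lra. }
      destruct (Hu (p a) x Kp Kx ltac:(lra)) as [HF Hux].
      unfold T. split.
      - rewrite eval_Taylor, Rabs_minus_sym.
        replace (u x - (u (p a) + dotd d (F (p a)) (vsub x (p a))))
          with (u x - u (p a) - dotd d (F (p a)) (vsub x (p a))) by ring.
        eapply Rle_trans; [exact Hux|]. apply Rmult_le_compat_l; lra.
      - intros i Hi. rewrite eval_diff_Taylor by auto. rewrite Rabs_minus_sym.
        eapply Rle_trans; [apply (coord_le_vnorm d (vsub (F x) (F (p a))) i Hi)|exact HF]. }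
    assert (H0 : active d d m (fun _ => O)) by (intros i Hi; lia).
    split.
    - apply (Grid_value d N s c T x m); auto. intros a Ha; now apply HT.
    - intros i Hi.
      replace (eta * Q) with (eta + INR d * (M * / s * (2 * A)))
        by (unfold A, Q; field; lra).
      apply (Grid_diff d N s c T x m M A eta (u x)); auto.
      + intros j. unfold basis. destruct (Nat.eqb j i); [rewrite Rabs_R1|rewrite Rabs_R0]; lra.
      + intros a Ha. split; apply HT; auto. }
  exists e. split; [now apply Grid_compact_support|].
  exists (2 * eta), (INR d * (eta * Q)). split; [|split].
  - replace eps with (eta * (3 + INR d * Q)) by (unfold eta; field; lra). nra.
  - intros x Kx. destruct (Hmain x Kx) as [E _]. assert (E' := Huf x Kx).
    rewrite Rabs_minus_sym. replace (eval e x - f x) with ((eval e x - u x) + (u x - f x)) by ring.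
    eapply Rle_trans; [apply Rabs_triang|]. lra.
  - intros x Kx. apply vnorm_le_coord; [nra|]. intros i Hi.
    unfold vsub. rewrite Rabs_minus_sym. now apply (Hmain x Kx).
Qed.

(** * Passage to the quotient norm and the density theorem *)

Lemma is_cont_deriv_restrict (d : nat) (A B : pt -> Prop) (f : pt -> R) (df : pt -> pt) :
  (forall x, B x -> A x) -> is_cont_deriv d A f df -> is_cont_deriv d B f df.
Proof.
  intros H [Hc Hd]. split; intros x Bx eps He.
  - destruct (Hc x (H x Bx) eps He) as (del & Hdel & Hy). exists del; auto.
  - destruct (Hd x (H x Bx) eps He) as (del & Hdel & Hy). exists del; auto.
Qed.

Lemma is_cont_deriv_minus (d : nat) (A : pt -> Prop) (f g : pt -> R) (df dg : pt -> pt) :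
  is_cont_deriv d A f df -> is_cont_deriv d A g dg ->
  is_cont_deriv d A (fun x => f x - g x) (fun x => vsub (df x) (dg x)).
Proof.
  intros [Hcf Hf] [Hcg Hg].
  split; intros x Ax eps He.
  - destruct (Hcf x Ax (eps / 2)) as (d1 & Hd1 & H1); [lra|].
    destruct (Hcg x Ax (eps / 2)) as (d2 & Hd2 & H2); [lra|].
    assert (M1 := Rmin_l d1 d2). assert (M2 := Rmin_r d1 d2).
    exists (Rmin d1 d2); split; [now apply Rmin_pos|]. intros y Ay Hy.
    specialize (H1 y Ay ltac:(lra)). specialize (H2 y Ay ltac:(lra)).
    (* Passing through the origin turns the metric triangle inequality into
       [|v - w| <= |v| + |w|]. *)
    assert (T := vnorm_triangle d (vsub (df y) (df x)) (fun _ => 0) (vsub (dg y) (dg x))).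
    rewrite (vnorm_vsub_sym d (fun _ => 0)) in T.
    rewrite !(vnorm_ext d (vsub _ (fun _ => 0)) _ (fun i _ => Rminus_0_r _)) in T.
    rewrite (vnorm_ext d _ (vsub (vsub (df y) (df x)) (vsub (dg y) (dg x))))
      by (intros; unfold vsub; ring).
    lra.
  - destruct (Hf x Ax (eps / 2)) as (d1 & Hd1 & H1); [lra|].
    destruct (Hg x Ax (eps / 2)) as (d2 & Hd2 & H2); [lra|].
    assert (M1 := Rmin_l d1 d2). assert (M2 := Rmin_r d1 d2).
    exists (Rmin d1 d2); split; [now apply Rmin_pos|]. intros y Ay Hy.
    specialize (H1 y Ay ltac:(lra)). specialize (H2 y Ay ltac:(lra)).
    rewrite dotd_vsub_l.
    replace (f y - g y - (f x - g x) - (dotd d (df x) (vsub y x) - dotd d (dg x) (vsub y x)))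
      with ((f y - f x - dotd d (df x) (vsub y x)) - (g y - g x - dotd d (dg x) (vsub y x))) by ring.
    eapply Rle_trans; [apply Rabs_triang|]. rewrite Rabs_Ropp. lra.
Qed.

Theorem mainTheorem11 (d : nat) (K : pt -> Prop) (HK : compactRd d K) :
  (* density of {(phi|_K, dphi|_K) : phi ∈ C_c^∞(R^d)} in J^1(K) *)
  (forall (f : pt -> R) (df : pt -> pt), is_cont_deriv d K f df ->
     forall eps, 0 < eps ->
       exists (phi : pt -> R) (D : list nat -> pt -> R),
         smooth_family d phi D /\ compact_support d phi /\
         exists a b, a + b < eps /\
           (forall x, K x -> Rabs (f x - phi x) <= a) /\
           (forall x, K x -> vnorm d (vsub (df x) (gradD D x)) <= b)) /\
  (* density of C^1(R^d|K) in C^1(K) for the quotient norm *)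
  (forall f : pt -> R, (exists df, is_cont_deriv d K f df) ->
     forall eps, 0 < eps ->
       exists g : pt -> R, (exists dg, is_cont_deriv d (inRd d) g dg) /\
         exists (dh : pt -> pt) a b,
           is_cont_deriv d K (fun x => f x - g x) dh /\ a + b < eps /\
           (forall x, K x -> Rabs (f x - g x) <= a) /\
           (forall x, K x -> vnorm d (dh x) <= b)).
Proof.
  split.
  - intros f df Hf eps He.
    destruct (smooth_approximation d K f df HK Hf eps He) as (e & Hsupp & Happ).
    exists (eval e), (fun l => eval (diffs l e)). split; [apply eval_smooth|]. now split.
  - intros f [df Hf] eps He.
    destruct (smooth_approximation d K f df HK Hf eps He) as (e & _ & a & b & Hab & Ha & Hb).
    exists (eval e). split; [eexists; apply eval_is_cont_deriv|].
    (* The quotient norm is an infimum, so one continuous derivative of the difference with a small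
       bound suffices. *)
    exists (fun x => vsub (df x) (gradD (fun l => eval (diffs l e)) x)), a, b.
    split; [|auto]. apply is_cont_deriv_minus; auto.
    apply is_cont_deriv_restrict with (inRd d); [apply HK|apply eval_is_cont_deriv].
Qed.
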